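(* Let $U \subseteq T/\{\pm 1\}$ with $1 \in U$ (i.e. $0 \in \arg(U)$) and $|U| \ge 4$. Let $P$ be the set of projections of elementary monomials onto the real axis along lines with angles from $U$. Then every monomial in $R(U)$ is a $\mathbb{Z}[P]$-linear combination of elementary monomials. Indeed, $R(U)$ is equal to the set of all $\mathbb{Z}[P]$-linear combinations of elementary monomials.
   Context: $T = \{z \in \mathbb{C} : |z| = 1\}$ is the unit circle, a group under multiplication, and $T/\{\pm 1\}$ is the set of angles: unit complex numbers $\alpha,\beta$ are identified iff $\alpha = \pm\beta$. Elements of $T/\{\pm1\}$ are represented by unit complex numbers $\alpha$ with argument $\arg(\alpha) \in [0,\pi)$, and $\arg(U) = \{\arg(\alpha) : \alpha \in U\}$. For $p \in \mathbb{C}$ and an angle $\alpha$, $L_\alpha(p) = p + \mathbb{R}\alpha$. For distinct angles $\alpha \ne \beta$ in $T/\{\pm1\}$ and $p,q \in \mathbb{C}$, $I_{\alpha,\beta}(p,q)$ is the unique point of $L_\alpha(p) \cap L_\beta(q)$. For $U \subseteq T/\{\pm1\}$, set $S_0 = \{0,1\}$, $S_{n+1} = \{I_{\alpha,\beta}(p,q) : \alpha,\beta \in U,\ \alpha \neq \pm\beta,\ p,q \in S_n\}$ for $n\ge 0$, and $R(U) = \bigcup_{n \ge 0} S_n$. Elementary monomials (length-one monomials) of $U$ are the points $I_{\alpha,\beta}(0,1)$ with $\alpha \ne \beta$ in $U$. Inductively, if $m$ is a length-$k$ monomial and $\alpha\neq\beta$ are in $U$, then $I_{\alpha,\beta}(0,m)$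 is a length-$(k+1)$ monomial. A monomial is a monomial of some length $k \ge 1$. The set of projections is $P = \{I_{1,\gamma}(0,z) : z \text{ an elementary monomial},\ \gamma \in U,\ \gamma \ne 1\} \subseteq \mathbb{R}$. $\mathbb{Z}[P]$ is the subring of $\mathbb{R}$ generated by $P$ (and $1$). A $\mathbb{Z}[P]$-linear combination is a finite sum $\sum c_i z_i$ with $c_i \in \mathbb{Z}[P]$. *)

(* Defs.v *)
From HB Require Import structures.
From mathcomp Require Import all_boot all_order all_algebra.
From mathcomp Require Import generic_quotient.
From mathcomp Require Import all_classical reals.
From mathcomp Require Import complex.

Set Implicit Arguments.
Unset Strict Implicit.
Unset Printing Implicit Defensive.

Import Order.TTheory GRing.Theory Num.Theory.

Local Open Scope classical_set_scope.
Local Open Scope ring_scope.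
Local Open Scope complex_scope.

Section Angles.
Variable R : realType.

Definition circle : Type := {z : R[i] | `|z| == 1}.
HB.instance Definition _ := SubChoice.on circle.

Definition circle1 : circle := exist _ 1 (introT eqP (normr1 R[i])).

Definition same_angle : rel circle :=
  fun a b => (val a == val b) || (val a == - val b).

Lemma same_angle_refl : reflexive same_angle.
Proof. by move=> a; rewrite /same_angle eqxx. Qed.

Lemma same_angle_sym : symmetric same_angle.
Proof.
move=> a b; rewrite /same_angle eq_sym; congr (_ || _).
by rewrite -eqr_oppLR eq_sym.
Qed.

Lemma same_angle_trans : transitive same_angle.
Proof.
move=> b a c /orP[] /eqP ab /orP[] /eqP bc.
- by rewrite /same_angle ab bc eqxx.
- by rewrite /same_angle ab bc eqxx orbT.
- by rewrite /same_angle ab bc eqxx orbT.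
- by rewrite /same_angle ab bc opprK eqxx.
Qed.

Canonical same_angle_equiv :=
  EquivRel same_angle same_angle_refl same_angle_sym same_angle_trans.

Definition angle : Type := {eq_quot same_angle}%qT.
HB.instance Definition _ := EqQuotient.on angle.
HB.instance Definition _ := Choice.on angle.

Definition angle1 : angle := (\pi circle1)%qT.

(* The line does not depend on the representative [repr alpha], which is only
   determined up to sign. *)
Definition line (alpha : angle) (p : R[i]) : set (R[i]) :=
  [set p + t%:C * val (repr alpha) | t in [set: R]].

(* For [alpha != beta] the intersection is a single point, and [xget] returns
   it; the default value 0 is then irrelevant. *)
Definition inter (alpha beta : angle) (p q : R[i]) : R[i] :=
  xget 0 (line alpha p `&` line beta q).

End Angles.

Arguments angle1 {R}.

Section Origami.
Variables (R : realType) (U : set (angle R)).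

Fixpoint origami_step (n : nat) : set (R[i]) :=
  if n is m.+1 then
    [set z | exists alpha beta p q,
       [/\ U alpha /\ U beta, alpha != beta,
           origami_step m p, origami_step m q & z = inter alpha beta p q]]
  else [set 0; 1].

Definition origami : set (R[i]) := \bigcup_n origami_step n.

Inductive monomial : nat -> R[i] -> Prop :=
| monomial1 (alpha beta : angle R) :
    U alpha -> U beta -> alpha != beta -> monomial 1 (inter alpha beta 0 1)
| monomialS (k : nat) (m : R[i]) (alpha beta : angle R) :
    monomial k m -> U alpha -> U beta -> alpha != beta ->
    monomial k.+1 (inter alpha beta 0 m).

Definition elementary : set (R[i]) := [set z | monomial 1 z].

(* [inter angle1 gamma 0 z] lies on the real axis, so the last condition loses
   no projection; taking [x] in [R] makes Z[P] a subring of the reals. *)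
Definition projections : set R :=
  [set x | exists z gamma,
     [/\ elementary z, U gamma, gamma != angle1
       & x%:C = inter angle1 gamma 0 z]].

Definition proj_ring : set R :=
  smallest [set A : set R | GRing.subring_closed (mem A)] projections.

Definition proj_lincomb : set (R[i]) :=
  [set w | exists (n : nat) (c : 'I_n -> R) (z : 'I_n -> R[i]),
     [/\ forall i, proj_ring (c i), forall i, elementary (z i)
       & w = \sum_(i < n) (c i)%:C * z i]].

End Origami.

(* Main.v *)
Require Import Defs.
From mathcomp Require Import all_boot all_order all_algebra.
From mathcomp Require Import generic_quotient.
From mathcomp Require Import all_classical reals.
From mathcomp Require Import complex.
From mathcomp Require Import ring.

Set Implicit Arguments.
Unset Strict Implicit.
Unset Printing Implicit Defensive.

Local Open Scope classical_set_scope.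
Local Open Scope card_scope.
Local Open Scope ring_scope.

(** For fixed distinct angles the map (p, q) |-> I(p, q) is real-linear, so
    R(U) can be transported by real affine maps: to show that x R(U) + p lies
    in R(U) it suffices to check the two seeds 0 and 1.  Three angles already
    give 2 and -1, hence R(U) is an additive group, and its real points form a
    ring containing Z[P].  Conversely I(p, q) = I(p, 0) + I(0, q) reduces
    everything to I_{alpha,beta}(0, z) with z elementary: if beta <> 1, replacing
    z by its projection x along beta gives x I_{alpha,beta}(0, 1); if beta = 1,
    the point is z - x with x the projection of z along alpha. *)

Import Order.TTheory GRing.Theory Num.Theory.

(** * Lines in the plane and real-linearity of their intersection points *)

Section Lines.
Local Open Scope complex_scope.
Variable R : realType.
Implicit Types (a b : angle R) (p q z w : R[i]) (x : R).

(** The determinant of two plane vectors, which detects whether they are parallel. *)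
Definition cross z w : R :=
  complex.Re z * complex.Im w - complex.Im z * complex.Re w.

Lemma angle_val_neq a b : a != b ->
  val (repr a) != val (repr b) /\ val (repr a) != - val (repr b).
Proof.
move=> ab; apply/andP; rewrite -negb_or; apply: contra ab => ab.
by rewrite -(reprK a) -(reprK b); apply/eqP/eqmodP.
Qed.

Lemma circle_sqr (c : circle R) :
  complex.Re (val c) ^+ 2 + complex.Im (val c) ^+ 2 = 1.
Proof.
case: c => [[u v] /= /eqP]; rewrite normc_def => -[] /= uv.
by rewrite -(@sqr_sqrtr _ (u ^+ 2 + v ^+ 2)) ?uv ?expr1n// addr_ge0 ?sqr_ge0.
Qed.

(** By Lagrange's identity the squares of the dot product and of the determinant of two unit vectors
    sum to 1. If the determinant vanishes, the dot product is 1 or -1, and expanding the squared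
    length of the difference, respectively of the sum, gives 0. *)
Lemma cross_neq0 a b : a != b -> cross (val (repr a)) (val (repr b)) != 0.
Proof.
move=> /angle_val_neq[]; have := circle_sqr (repr a).
have := circle_sqr (repr b).
case: (val (repr a)) (val (repr b)) => [a1 a2] [b1 b2] /= hb ha ab abN.
apply/eqP; rewrite /cross /= => c0.
have : (a1 * b1 + a2 * b2) ^+ 2 = 1.
  have -> : (a1 * b1 + a2 * b2) ^+ 2 =
    (a1 ^+ 2 + a2 ^+ 2) * (b1 ^+ 2 + b2 ^+ 2) - (a1 * b2 - a2 * b1) ^+ 2 by ring.
  by rewrite ha hb c0; ring.
have sq0 (u v : R) : u ^+ 2 + v ^+ 2 = 0 -> u = 0 /\ v = 0.
  by move=> /eqP; rewrite paddr_eq0 ?sqr_ge0// !sqrf_eq0 => /andP[/eqP-> /eqP->].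
move=> /eqP; rewrite sqrf_eq1 => /orP[] /eqP dot.
- have [] : a1 - b1 = 0 /\ a2 - b2 = 0.
    apply: sq0.
    have -> : (a1 - b1) ^+ 2 + (a2 - b2) ^+ 2 = (a1 ^+ 2 + a2 ^+ 2) +
      (b1 ^+ 2 + b2 ^+ 2) - 2 * (a1 * b1 + a2 * b2) by ring.
    by rewrite ha hb dot; ring.
  move=> /eqP; rewrite subr_eq0 => /eqP e1 /eqP; rewrite subr_eq0 => /eqP e2.
  by rewrite e1 e2 eqxx in ab.
- have [] : a1 + b1 = 0 /\ a2 + b2 = 0.
    apply: sq0.
    have -> : (a1 + b1) ^+ 2 + (a2 + b2) ^+ 2 = (a1 ^+ 2 + a2 ^+ 2) +
      (b1 ^+ 2 + b2 ^+ 2) + 2 * (a1 * b1 + a2 * b2) by ring.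
    by rewrite ha hb dot; ring.
  move=> /eqP; rewrite addr_eq0 => /eqP e1 /eqP; rewrite addr_eq0 => /eqP e2.
  move: abN; rewrite e1 e2 => /eqP; apply.
  by apply/eqP; rewrite eq_complex /= !eqxx.
Qed.

Lemma line_refl a p : line a p p.
Proof. by exists 0 => //; rewrite mul0r addr0. Qed.

Lemma line_sym a p q : line a p q -> line a q p.
Proof. by move=> [t _ <-]; exists (- t) => //; rewrite rmorphN /=; ring. Qed.

Lemma line_trans a p q z : line a p q -> line a q z -> line a p z.
Proof.
by move=> [t _ <-] [s _ <-]; exists (t + s) => //; rewrite rmorphD /=; ring.
Qed.

Lemma lineD a p p' z z' : line a p z -> line a p' z' -> line a (p + p') (z + z').
Proof.
by move=> [t _ <-] [s _ <-]; exists (t + s) => //; rewrite rmorphD /=; ring.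
Qed.

Lemma lineZ a x p z : line a p z -> line a (x%:C * p) (x%:C * z).
Proof.
by move=> [t _ <-]; exists (x * t) => //; rewrite rmorphM /=; ring.
Qed.

Lemma repr_angle1 :
  val (repr (@angle1 R)) = 1 \/ val (repr (@angle1 R)) = -1.
Proof.
have /eqmodP : repr angle1 = circle1 R %[mod angle R]%qT.
  by rewrite reprK.
by case/orP => /eqP ->; [left|right].
Qed.

Lemma line1E p z : line angle1 p z <-> exists x : R, z = p + x%:C.
Proof.
rewrite /line /=; case: repr_angle1 => ->; split.
- by move=> [t _ <-]; exists t; rewrite mulr1.
- by move=> [t ->]; exists t; rewrite ?mulr1.
- by move=> [t _ <-]; exists (- t); rewrite mulrN1 rmorphN.
- by move=> [t ->]; exists (- t); rewrite // rmorphN mulrN1 opprK.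
Qed.

Lemma line_inter_ex a b p q : a != b -> exists z, line a p z /\ line b q z.
Proof.
move=> /cross_neq0; rewrite /line /=.
move: (val (repr a)) (val (repr b)) => u v c0.
(* Cramer's rule for [p + t u = q + s v]: taking determinants with [v] eliminates [s], and with [u]
   eliminates [t]. *)
set t := cross (q - p) v / cross u v; set s := cross (q - p) u / cross u v.
exists (p + t%:C * u); split; first by exists t.
exists s => //; rewrite /t /s {t s}.
case: u v p q c0 => [u1 u2] [v1 v2] [p1 p2] [q1 q2]; rewrite /cross /= => c0.
by apply/eqP; rewrite eq_complex /=; apply/andP; split; apply/eqP; field.
Qed.

Lemma line_inter_uniq a b p q z w : a != b ->
  line a p z -> line b q z -> line a p w -> line b q w -> z = w.
Proof.
move=> ab az bz aw bw.
have [t _ tE] := line_trans (line_sym az) aw.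
have [s _ sE] := line_trans (line_sym bz) bw.
(* The difference [w - z] is a real multiple of both directions, so its determinant with the second
   one vanishes. *)
have : cross (t%:C * val (repr a)) (val (repr b)) = 0.
  have -> : t%:C * val (repr a) = s%:C * val (repr b).
    by apply: (addrI z); rewrite tE sE.
  by case: (val (repr b)) => b1 b2; rewrite /cross /=; ring.
have -> : cross (t%:C * val (repr a)) (val (repr b)) =
    t * cross (val (repr a)) (val (repr b)).
  case: (val (repr a)) (val (repr b)) => [a1 a2] [b1 b2].
  by rewrite /cross /=; ring.
move/eqP; rewrite mulf_eq0 (negPf (cross_neq0 ab)) orbF => /eqP t0.
by rewrite -tE t0 mul0r addr0.
Qed.

Lemma interP a b p q : a != b ->
  line a p (inter a b p q) /\ line b q (inter a b p q).
Proof.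
move=> ab; have [z zE] := line_inter_ex p q ab.
by have := @xgetI _ 0 (line a p `&` line b q) z zE.
Qed.

Lemma inter_eq a b p q z : a != b ->
  line a p z -> line b q z -> inter a b p q = z.
Proof.
by move=> ab az bz; have [aw bw] := interP p q ab; exact: line_inter_uniq az bz.
Qed.

Lemma inter_sym a b p q : a != b -> inter a b p q = inter b a q p.
Proof.
move=> ab; have ba : b != a by rewrite eq_sym.
by have [] := interP q p ba; move=> ? ?; apply: inter_eq.
Qed.

Lemma interD a b p p' q q' : a != b ->
  inter a b (p + p') (q + q') = inter a b p q + inter a b p' q'.
Proof.
move=> ab; have [? ?] := interP p q ab; have [? ?] := interP p' q' ab.
by apply: inter_eq => //; apply: lineD.
Qed.

Lemma interZ a b x p q : a != b ->
  inter a b (x%:C * p) (x%:C * q) = x%:C * inter a b p q.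
Proof.
by move=> ab; have [? ?] := interP p q ab; apply: inter_eq => //; apply: lineZ.
Qed.

Lemma inter_diag a b p : a != b -> inter a b p p = p.
Proof. by move=> ab; apply: inter_eq => //; exact: line_refl. Qed.

(** The pair (p, q) is (p, 0) + (0, q). The angles are swapped in the first term so that both terms
    have base point 0, the shape found in monomials. *)
Lemma inter_split a b p q : a != b ->
  inter a b p q = inter b a 0 p + inter a b 0 q.
Proof.
by move=> ab; rewrite -(inter_sym _ _ ab) -interD// addr0 add0r.
Qed.

Lemma inter_sum a b n (z : 'I_n -> R[i]) : a != b ->
  inter a b 0 (\sum_i z i) = \sum_i inter a b 0 (z i).
Proof.
move=> ab; elim/big_ind2: _ => [|y z1 y' z2 <- <-|//]; first exact: inter_diag.
by rewrite -interD// addr0.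
Qed.

End Lines.

(** * Additive and multiplicative closure of R(U), from three angles 1, [alpha], [beta] *)

Section OrigamiRing.
Local Open Scope complex_scope.
Variables (R : realType) (U : set (angle R)).
Hypothesis U1 : U angle1.
Variables alpha beta : angle R.
Hypotheses (Ualpha : U alpha) (Ubeta : U beta).
Hypotheses (alpha1 : alpha != angle1) (beta1 : beta != angle1).
Hypothesis alpha_beta : alpha != beta.
Implicit Types (p q z w : R[i]) (x : R).

Lemma origami0 : origami U 0.
Proof. by exists 0%N => //; left. Qed.

Lemma origami1 : origami U 1.
Proof. by exists 0%N => //; right. Qed.

(** Each point z survives to the next stage as the intersection of its own two lines, along [alpha]
    and [beta]. *)
Lemma origami_step_le m n : (m <= n)%N -> origami_step U m `<=` origami_step U n.
Proof.
move=> /subnK <-; elim: (n - m)%N => [//|k IH] z /IH kz.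
by exists alpha, beta, z, z; split => //; rewrite inter_diag.
Qed.

Lemma origami_inter a b p q : U a -> U b -> a != b ->
  origami U p -> origami U q -> origami U (inter a b p q).
Proof.
move=> Ua Ub ab [m _ mp] [n _ nq]; exists (maxn m n).+1 => //.
exists a, b, p, q; split => //.
- exact: origami_step_le (leq_maxl _ _) _ mp.
- exact: origami_step_le (leq_maxr _ _) _ nq.
Qed.

Lemma origami_ind (P : R[i] -> Prop) : P 0 -> P 1 ->
  (forall a b p q, U a -> U b -> a != b -> P p -> P q -> P (inter a b p q)) ->
  forall z, origami U z -> P z.
Proof.
move=> P0 P1 PI z [n _]; elim: n z => [z [->|->]//|n IH z].
by move=> [a [b [p [q [[Ua Ub] ab /IH Pp /IH Pq ->]]]]]; exact: PI.
Qed.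

Lemma origami_affine x p : origami U p -> origami U (x%:C + p) ->
  forall z, origami U z -> origami U (x%:C * z + p).
Proof.
move=> Rp Rxp; apply: origami_ind => [||a b u v Ua Ub ab Ru Rv].
- by rewrite mulr0 add0r.
- by rewrite mulr1.
(* The translation vector p is written as [inter a b p p], so that the affine image of an
   intersection becomes a single intersection of affine images. *)
- rewrite -interZ// -[X in _ + X](inter_diag p ab) -interD//.
  exact: origami_inter.
Qed.

(** The apex of the triangle on the base from 0 to 1 with sides along [alpha] and [beta]. *)
Let vertex := inter alpha beta 0 1.

Lemma vertex_alpha : line alpha 0 vertex.
Proof. by case: (interP 0 1 alpha_beta). Qed.

Lemma vertex_beta : line beta 1 vertex.
Proof. by case: (interP 0 1 alpha_beta). Qed.

Lemma origami_vertex : origami U vertex.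
Proof. by apply: origami_inter => //; [exact: origami0|exact: origami1]. Qed.

(** The triangle is shifted right by 1: its apex lies at the height of [vertex] on the [alpha]-line
    through 1, and the [beta]-line down from it meets the real axis at 2. *)
Lemma origami2 : origami U 2.
Proof.
have RvD1 : origami U (vertex + 1).
  have -> : vertex + 1 = inter angle1 alpha vertex 1.
    apply/esym/inter_eq; first by rewrite eq_sym.
    - by apply/line1E; exists 1.
    - by have := lineD vertex_alpha (line_refl alpha 1); rewrite add0r.
  by apply: origami_inter => //;
    [rewrite eq_sym | exact: origami_vertex | exact: origami1].
have -> : 2 = inter angle1 beta 0 (vertex + 1).
  apply/esym/inter_eq; first by rewrite eq_sym.
  - by apply/line1E; exists 2; rewrite add0r rmorph_nat.
  - exact: lineD (line_sym vertex_beta) (line_refl beta 1).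
by apply: origami_inter => //; [rewrite eq_sym|exact: origami0].
Qed.

(** The triangle is shifted left by 1: its apex lies on the [beta]-line through 0, and the
    [alpha]-line down from it meets the real axis at -1. *)
Lemma origamiN1 : origami U (-1).
Proof.
have RvB1 : origami U (vertex - 1).
  have -> : vertex - 1 = inter angle1 beta vertex 0.
    apply/esym/inter_eq; first by rewrite eq_sym.
    - by apply/line1E; exists (-1); rewrite rmorphN.
    - by have := lineD vertex_beta (line_refl beta (-1)); rewrite subrr.
  by apply: origami_inter => //;
    [rewrite eq_sym | exact: origami_vertex | exact: origami0].
have -> : -1 = inter angle1 alpha 0 (vertex - 1).
  apply/esym/inter_eq; first by rewrite eq_sym.
  - by apply/line1E; exists (-1); rewrite add0r rmorphN.
  - have := lineD (line_sym vertex_alpha) (line_refl alpha (-1)).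
    by rewrite add0r.
by apply: origami_inter => //; [rewrite eq_sym|exact: origami0].
Qed.

(** Translation by 1 sends the seeds to 1 and 2, so [w + 1] lies in R(U). Translation by w then
    sends the seeds to w and [1 + w]. *)
Lemma origamiD z w : origami U z -> origami U w -> origami U (z + w).
Proof.
move=> Rz Rw; rewrite -[z]mul1r.
apply: (@origami_affine 1) => //.
have := @origami_affine 1 1 origami1 origami2 _ Rw.
by rewrite mul1r addrC.
Qed.

Lemma origamiM x z : origami U x%:C -> origami U z -> origami U (x%:C * z).
Proof.
move=> Rx Rz; rewrite -[_ * _]addr0; apply: origami_affine => //.
  exact: origami0.
by rewrite addr0.
Qed.

Lemma origamiN z : origami U z -> origami U (- z).
Proof.
move=> Rz; have := @origamiM (-1) z; rewrite rmorphN mulN1r; apply=> //.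
exact: origamiN1.
Qed.

Lemma origami_monomial k z : monomial U k z -> origami U z.
Proof.
elim=> [a b Ua Ub ab|n m a b _ Rm Ua Ub ab]; apply: origami_inter => //;
  by [exact: origami0|exact: origami1].
Qed.

Lemma projections_origami x : projections U x -> origami U x%:C.
Proof.
move=> [z [c [/origami_monomial Rz Uc c1 ->]]].
by apply: origami_inter => //; [rewrite eq_sym|exact: origami0].
Qed.

(** By minimality of Z[P]. Closure of the real points of R(U) under products is [origamiM] applied
    to a real second factor. *)
Lemma proj_ring_origami x : proj_ring U x -> origami U x%:C.
Proof.
apply: (smallest_sub (X := [set x | origami U x%:C])); last first.
  exact: projections_origami.
split; rewrite ?inE.
- exact: origami1.
- move=> u v; rewrite !inE /= => Ru Rv; rewrite rmorphB.
  by apply: origamiD => //; exact: origamiN.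
- by move=> u v; rewrite !inE /= => Ru Rv; rewrite rmorphM; exact: origamiM.
Qed.

Lemma proj_lincomb_origami : proj_lincomb U `<=` origami U.
Proof.
move=> _ [n [c [z [Zc Ez ->]]]]; elim/big_ind: _ => [||i _].
- exact: origami0.
- exact: origamiD.
- by apply: origamiM; [exact: proj_ring_origami|exact: origami_monomial (Ez i)].
Qed.

(** * The ring Z[P] and the module of linear combinations over it *)

Lemma proj_ring_closed : GRing.subring_closed (mem (proj_ring U)).
Proof.
split; rewrite ?inE.
- by move=> A [[+ _ _] _]; rewrite inE.
- move=> u v; rewrite !inE => Pu Pv A A_closed.
  have := Pu _ A_closed; have := Pv _ A_closed; case: A_closed => -[_ AB _] _.
  by move=> Av Au; have := AB u v; rewrite !inE; apply.
- move=> u v; rewrite !inE => Pu Pv A A_closed.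
  have := Pu _ A_closed; have := Pv _ A_closed; case: A_closed => -[_ _ AM] _.
  by move=> Av Au; have := AM u v; rewrite !inE; apply.
Qed.

Lemma proj_ring1 : proj_ring U 1.
Proof. by have [+ _ _] := proj_ring_closed; rewrite inE. Qed.

Lemma proj_ringB x y : proj_ring U x -> proj_ring U y -> proj_ring U (x - y).
Proof. by have [_ + _] := proj_ring_closed => /(_ x y); rewrite !inE; apply. Qed.

Lemma proj_ringM x y : proj_ring U x -> proj_ring U y -> proj_ring U (x * y).
Proof. by have [_ _ +] := proj_ring_closed => /(_ x y); rewrite !inE; apply. Qed.

Lemma proj_ringN1 : proj_ring U (-1).
Proof.
have := proj_ringB (proj_ringB proj_ring1 proj_ring1) proj_ring1.
by rewrite subrr sub0r.
Qed.

Lemma proj_ringP x : projections U x -> proj_ring U x.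
Proof. exact: sub_gen_smallest. Qed.

Lemma proj_lincomb0 : proj_lincomb U 0.
Proof. by exists 0%N, (fun=> 0), (fun=> 0); split; [case|case|rewrite big_ord0]. Qed.

Lemma proj_lincombD z w :
  proj_lincomb U z -> proj_lincomb U w -> proj_lincomb U (z + w).
Proof.
move=> [n [c [u [Zc Eu ->]]]] [m [d [v [Zd Ev ->]]]].
exists (n + m)%N, (fun i : 'I_(n + m) =>
  match fintype.split i with inl j => c j | inr j => d j end).
exists (fun i : 'I_(n + m) => match fintype.split i with inl j => u j | inr j => v j end); split.
- by move=> i; case: (fintype.split i).
- by move=> i; case: (fintype.split i).
- rewrite big_split_ord /=; congr (_ + _); apply: eq_bigr => i _.
    by rewrite (unsplitK (inl i)).
  by rewrite (unsplitK (inr i)).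
Qed.

Lemma proj_lincombZ x z :
  proj_ring U x -> proj_lincomb U z -> proj_lincomb U (x%:C * z).
Proof.
move=> Zx [n [c [u [Zc Eu ->]]]]; exists n, (fun i => x * c i), u; split => //.
- by move=> i; exact: proj_ringM.
- by rewrite mulr_sumr; apply: eq_bigr => i _; rewrite rmorphM mulrA.
Qed.

Lemma elementary_lincomb z : elementary U z -> proj_lincomb U z.
Proof.
move=> Ez; exists 1%N, (fun=> 1), (fun=> z); split => // [_|].
  exact: proj_ring1.
by rewrite big_ord1 mul1r.
Qed.

(** The [alpha]-line through 1 meets the real axis at 1 itself. This puts the seed 1 and all
    elements of Z[P] among the linear combinations. *)
Lemma elementary_one : elementary U 1.
Proof.
have a1 : angle1 != alpha by rewrite eq_sym.
have -> : 1 = inter angle1 alpha 0 1 :> R[i].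
  apply/esym/inter_eq => //; last exact: line_refl.
  by apply/line1E; exists 1; rewrite add0r.
exact: monomial1.
Qed.

(** * Stability of linear combinations under intersection *)

Lemma inter1_real b z : angle1 != b ->
  exists x, x%:C = inter angle1 b 0 z.
Proof.
by move=> b1; have [/line1E[x ->] _] := interP 0 z b1; exists x; rewrite add0r.
Qed.

Lemma inter_elementary a b z : U a -> U b -> a != b -> elementary U z ->
  proj_lincomb U (inter a b 0 z).
Proof.
move=> Ua Ub ab Ez; have [b1|b1] := eqVneq b angle1.
  rewrite b1 in ab *; have a1 : angle1 != a by rewrite eq_sym.
  have [x xE] := inter1_real z a1.
  have Zx : proj_ring U x by apply: proj_ringP; exists z, a.
  (* [inter_split] with both points equal to z decomposes z into its real projection x and the
     desired point. The term -x is written as a multiple of the elementary monomial 1. *)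
  have -> : inter a angle1 0 z = z + (-1)%:C * (x%:C * 1).
    have := inter_split z z ab; rewrite inter_diag// -xE => {2}->.
    by rewrite rmorphN; ring.
  apply: proj_lincombD; first exact: elementary_lincomb.
  apply: proj_lincombZ proj_ringN1 _; apply: proj_lincombZ Zx _.
  exact: elementary_lincomb elementary_one.
have b1' : angle1 != b by rewrite eq_sym.
have [x xE] := inter1_real z b1'.
have Zx : proj_ring U x by apply: proj_ringP; exists z, b.
(* The points z and x lie on the same [b]-line, so z may be replaced by x, and the real factor x
   then comes out by homogeneity. *)
have -> : inter a b 0 z = x%:C * inter a b 0 1.
  rewrite -interZ// mulr0 mulr1 xE; have [_ bx] := interP 0 z b1'.
  have [ax' bx'] := interP 0 (inter angle1 b 0 z) ab.
  by apply: inter_eq => //; exact: line_trans bx bx'.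
apply: proj_lincombZ => //; apply: elementary_lincomb.
exact: monomial1.
Qed.

Lemma inter_lincomb a b z : U a -> U b -> a != b -> proj_lincomb U z ->
  proj_lincomb U (inter a b 0 z).
Proof.
move=> Ua Ub ab [n [c [u [Zc Eu ->]]]]; rewrite inter_sum//.
elim/big_ind: _ => [||i _].
- exact: proj_lincomb0.
- exact: proj_lincombD.
- rewrite -[0](mulr0 (c i)%:C) interZ//; apply: proj_lincombZ (Zc i) _.
  exact: inter_elementary.
Qed.

Lemma monomial_lincomb k z : monomial U k z -> proj_lincomb U z.
Proof.
elim=> [a b Ua Ub ab|n m a b _ Lm Ua Ub ab]; last exact: inter_lincomb.
by apply: elementary_lincomb; exact: monomial1.
Qed.

Lemma origami_lincomb : origami U `<=` proj_lincomb U.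
Proof.
apply: origami_ind => [||a b p q Ua Ub ab Lp Lq].
- exact: proj_lincomb0.
- exact: elementary_lincomb elementary_one.
- rewrite inter_split//; apply: proj_lincombD; apply: inter_lincomb => //.
  by rewrite eq_sym.
Qed.

End OrigamiRing.

(** * Extraction of two further angles from the cardinality bound *)

Lemma two_angles_neq1 (R : realType) (U : set (angle R)) : `I_4 #<= U ->
  exists a b, [/\ U a /\ U b, a != angle1, b != angle1 & a != b].
Proof.
move=> /card_leP[h]; have I0 : `I_4 0%N by [].
(* The injection [h] is extended to all naturals by sending indices from 4 on to the value at 0;
   injectivity is claimed only below 4. *)
pose f (i : nat) : angle R := val (h (insubd (SigSub (mem_set I0)) i)).
have fU i : U (f i) by exact/set_mem/valP.
have f_inj (i j : nat) : (i < 4)%N -> (j < 4)%N -> i != j -> f i != f j.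
  move=> i4 j4; apply: contra => /eqP/val_inj/(@inj _ _ _ h).
  rewrite !inE => /(_ I I)/(congr1 val); rewrite !val_insubd.
  by rewrite !(mem_set (A := `I_4))// => ->.
(* At most one value of [f] below 4 is [angle1]; once its index is known, two others are chosen. *)
have [f0|f0] := eqVneq (f 0%N) angle1.
  by exists (f 1%N), (f 2%N); split; rewrite -?f0 ?f_inj.
have [f1|f1] := eqVneq (f 1%N) angle1.
  by exists (f 0%N), (f 2%N); split; rewrite -?f1 ?f_inj.
by exists (f 0%N), (f 1%N); split; rewrite ?f_inj.
Qed.

Theorem theorem3p5 (R : realType) (U : set (angle R))
    (U1 : U angle1) (cardU : `I_4 #<= U) :
  (forall (k : nat) (z : R[i]), monomial U k z -> proj_lincomb U z) /\
  origami U = proj_lincomb U.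
Proof.
have [a [b [[Ua Ub] a1 b1 ab]]] := two_angles_neq1 cardU.
split; first exact: (monomial_lincomb U1 Ua a1).
apply/seteqP; split; first exact: (origami_lincomb U1 Ua a1).
exact: (proj_lincomb_origami U1 Ua Ub a1 b1 ab).
Qed.
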